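(* Let $n$ be any positive integer. Then every non-identity congruence $\mathfrak{C}$ on the semigroup $\mathscr{IPF}(\mathbb{N}^n)$ is a group congruence, i.e. the quotient semigroup $\mathscr{IPF}(\mathbb{N}^n)/\mathfrak{C}$ is a group.
   Context: $\mathbb{N}$ is the set of positive integers; $(\mathbb{N}^n,\leqslant)$ carries the product (coordinatewise) order; ${\uparrow}\mathbf{x}=\{\mathbf{y}\in\mathbb{N}^n:\mathbf{x}\leqslant\mathbf{y}\}$ is the principal filter generated by $\mathbf{x}$. $\mathscr{IPF}(\mathbb{N}^n)$ is the semigroup of all order isomorphisms between principal filters of $(\mathbb{N}^n,\leqslant)$, with composition of partial maps (maps written on the right, composed left to right, $z(\alpha\beta)=(z\alpha)\beta$ wherever defined). A congruence is an equivalence relation compatible with left and right multiplication; the identity congruence is equality. *)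

(* Defs.v *)
From HB Require Import structures.
From mathcomp Require Import all_boot all_order.
From mathcomp Require Import boolp classical_sets.

Set Implicit Arguments.
Unset Strict Implicit.
Unset Printing Implicit Defensive.

Import Order.TTheory.

Local Open Scope classical_set_scope.
Local Open Scope order_scope.

Definition posnat : Type := {k : nat | (0 < k)%N}.

HB.instance Definition _ := SubChoice.on posnat.
HB.instance Definition _ :=
  [SubChoice_isSubOrder of posnat by <: with Order.NatOrder.nat_display].

Lemma le_posnatE (k l : posnat) : (k <= l) = (val k <= val l)%N.
Proof. by []. Qed.

(* The points of N^n; the library order on this alias is the coordinatewise
   order, with joins and meets computed coordinatewise. *)
Definition Npow (n : nat) := n.-tupleprod posnat.

HB.instance Definition _ n := Order.Lattice.on (Npow n).

Lemma le_NpowE n (x y : Npow n) :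
  (x <= y) = [forall i, (val (tnth x i) <= val (tnth y i))%N].
Proof.
by rewrite leEtprod; apply: eq_forallb => i; rewrite le_posnatE.
Qed.

(* Partial maps are option-valued functions. *)
Section PrincipalFilters.
Context {d : Order.disp_t} {T : latticeType d}.
Implicit Types (f g : T -> option T) (x y z w : T).

Definition pfilter x : set T := [set y | x <= y].

Definition pdom f : set T := [set z | exists w, f z = Some w].

Definition pimg f : set T := [set w | exists z, f z = Some w].

Definition porder_iso f : Prop :=
  forall z1 z2 w1 w2, f z1 = Some w1 -> f z2 = Some w2 ->
    (w1 <= w2) = (z1 <= z2).

Definition pfilter_iso f : Prop :=
  exists x y, [/\ pdom f = pfilter x, pimg f = pfilter y & porder_iso f].

Lemma porder_iso_inj f z1 z2 w : porder_iso f ->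
  f z1 = Some w -> f z2 = Some w -> z1 = z2.
Proof.
move=> fI f1 f2; apply: le_anti.
by rewrite -(fI _ _ _ _ f1 f2) -(fI _ _ _ _ f2 f1) lexx.
Qed.

(* [pcomp g f z] is [obind g (f z)]: [f] is applied first. *)
Lemma pfilter_iso_comp f g :
  pfilter_iso f -> pfilter_iso g -> pfilter_iso (pcomp g f).
Proof.
move=> [x [y [fD fR fI]]] [u [v [gD gR gI]]].
have compE z w : pcomp g f z = Some w <->
    exists2 t, f z = Some t & g t = Some w.
  rewrite /pcomp; split; last by move=> [t -> /=].
  by case: (f z) => [t|] //= gt; exists t.
have [a fa] : pimg f (y `|` u) by rewrite fR /pfilter /= leUl.
have [b gb] : pdom g (y `|` u) by rewrite gD /pfilter /= leUr.
have domg z t : g z = Some t -> u <= z.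
  by move=> gz; have : pdom g z by [exists t]; rewrite gD.
have imf z t : f z = Some t -> y <= t.
  by move=> fz; have : pimg f t by [exists z]; rewrite fR.
have xa : x <= a by have : pdom f a by [exists (y `|` u)]; rewrite fD.
have vb : v <= b by have : pimg g b by [exists (y `|` u)]; rewrite gR.
exists a, b; split.
- rewrite eqEsubset; split=> z.
    move=> [w /compE[t fz gt]]; rewrite /pfilter /= -(fI _ _ _ _ fa fz).
    by rewrite leUx (imf _ _ fz) (domg _ _ gt).
  rewrite /pfilter /= => az.
  have [t fz] : pdom f z by rewrite fD /pfilter /= (le_trans xa).
  have [w gt] : pdom g t.
    rewrite gD /pfilter /=; apply: (@le_trans _ _ (y `|` u)).
      exact: leUr.
    by rewrite (fI _ _ _ _ fa fz).
  by exists w; apply/compE; exists t.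
- rewrite eqEsubset; split=> w.
    move=> [z /compE[t fz gt]]; rewrite /pfilter /= (gI _ _ _ _ gb gt).
    by rewrite leUx (imf _ _ fz) (domg _ _ gt).
  rewrite /pfilter /= => bw.
  have [t gt] : pimg g w by rewrite gR /pfilter /= (le_trans vb).
  have [z fz] : pimg f t.
    rewrite fR /pfilter /=; apply: (@le_trans _ _ (y `|` u)).
      exact: leUl.
    by rewrite -(gI _ _ _ _ gb gt).
  by exists z; apply/compE; exists t.
- move=> z1 z2 w1 w2 /compE[t1 f1 g1] /compE[t2 f2 g2].
  by rewrite (gI _ _ _ _ g1 g2) (fI _ _ _ _ f1 f2).
Qed.

End PrincipalFilters.

Record ipf (n : nat) : Type := Ipf {
  ipf_fun :> Npow n -> option (Npow n);
  ipf_iso : pfilter_iso ipf_fun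
}.

HB.instance Definition _ n := gen_eqMixin (ipf n).
HB.instance Definition _ n := gen_choiceMixin (ipf n).

Lemma ipf_ext n (a b : ipf n) : ipf_fun a =1 ipf_fun b -> a = b.
Proof.
case: a b => [f fP] [g gP] /= /funext fg.
by case: _ / fg gP => gP; congr Ipf; exact: Prop_irrelevance.
Qed.

(* Maps act on the right: [z (a b) = (z a) b]. *)
Definition ipf_mul n (a b : ipf n) : ipf n :=
  Ipf (pfilter_iso_comp (ipf_iso a) (ipf_iso b)).

Lemma ipf_mulA n : associative (@ipf_mul n).
Proof.
move=> a b c; apply: ipf_ext => z /=.
by rewrite /pcomp /=; case: (ipf_fun a z).
Qed.

HB.instance Definition _ n := isSemigroup.Build (ipf n) (@ipf_mulA n).

Local Open Scope group_scope.

Record congruence (S : semigroupType) : Type := Congruence {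
  cong_rel :> S -> S -> Prop;
  cong_refl : forall a, cong_rel a a;
  cong_sym : forall a b, cong_rel a b -> cong_rel b a;
  cong_trans : forall a b c, cong_rel a b -> cong_rel b c -> cong_rel a c;
  cong_mul2l : forall c a b, cong_rel a b -> cong_rel (c * a) (c * b);
  cong_mul2r : forall c a b, cong_rel a b -> cong_rel (a * c) (b * c)
}.

Definition identity_congruence (S : semigroupType) (C : congruence S) : Prop :=
  forall a b, C a b <-> a = b.

Section Quotient.
Context {S : semigroupType} (C : congruence S).
Local Open Scope quotient_scope.

Definition cong_op : rel S := fun a b => `[< C a b >].

Lemma cong_op_refl : reflexive cong_op.
Proof. by move=> a; apply/asboolP; exact: cong_refl. Qed.

Lemma cong_op_sym : symmetric cong_op.
Proof. by move=> a b; apply/asboolP/asboolP; exact: cong_sym. Qed.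

Lemma cong_op_trans : transitive cong_op.
Proof.
by move=> b a c /asboolP ab /asboolP bc; apply/asboolP; exact: cong_trans bc.
Qed.

Canonical cong_equiv := EquivRel cong_op cong_op_refl cong_op_sym cong_op_trans.

Definition cong_quot : Type := {eq_quot cong_op}.

HB.instance Definition _ := Choice.on cong_quot.
HB.instance Definition _ := EqQuotient.on cong_quot.

Definition cong_quot_mul : cong_quot -> cong_quot -> cong_quot :=
  lift_op2 cong_quot (fun a b : S => a * b).

Lemma cong_quotP (a b : S) : \pi_cong_quot a = \pi_cong_quot b <-> C a b.
Proof.
by split=> [/eqmodP/asboolP //|ab]; apply/eqmodP/asboolP.
Qed.

Lemma cong_quot_mulE (a b : S) :
  cong_quot_mul (\pi_cong_quot a) (\pi_cong_quot b) = \pi_cong_quot (a * b).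
Proof.
rewrite /cong_quot_mul; unlock; apply/cong_quotP.
apply: (cong_trans (b := a * repr (\pi_cong_quot b))).
  by apply/cong_mul2r/cong_quotP; rewrite reprK.
by apply/cong_mul2l/cong_quotP; rewrite reprK.
Qed.

Lemma cong_quot_mulA : associative cong_quot_mul.
Proof.
move=> x y z; rewrite -[x]reprK -[y]reprK -[z]reprK.
by rewrite !cong_quot_mulE mulgA.
Qed.

HB.instance Definition _ := isSemigroup.Build cong_quot cong_quot_mulA.

End Quotient.

Definition is_group (G : semigroupType) : Prop :=
  exists (e : G) (inv : G -> G),
    [/\ left_id e *%g, right_id e *%g,
        left_inverse e inv *%g & right_inverse e inv *%g].

Definition group_congruence (S : semigroupType) (C : congruence S) : Prop :=
  is_group (cong_quot C).

(* Main.v *)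
(* The idempotents of IPF(N^n) are the identity maps eps x of the filters
   above x.  If a C b with a <> b, restricting a and b to the filter of a point
   where they differ and cancelling one of them gives eps x C eps y for some
   x < y.  Conjugating by a translation composed with a coordinate
   transposition moves this pair to eps z C eps w with w >= z + e_j, for
   any z and j, and since C-classes of idempotents are convex,
   eps z C eps (z + e_j).  So all idempotents are congruent to the identity
   map, and the partial inverses become inverses in the quotient. *)
Require Import Defs.
From mathcomp Require Import all_boot all_order.
From mathcomp Require Import boolp classical_sets.
From mathcomp Require Import perm zify.

Set Implicit Arguments.
Unset Strict Implicit.
Unset Printing Implicit Defensive.

Import Order.TTheory.

(** * Identity maps of filters and inverses of partial isomorphisms *)

Section PartialIsomorphisms.
Context {d : Order.disp_t} {T : latticeType d}.
Implicit Types (f g : T -> option T) (x y z w : T).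
Local Open Scope order_scope.
Local Open Scope classical_set_scope.

Definition idfilter x z : option T := if x <= z then Some z else None.

Lemma idfilterP x z w : idfilter x z = Some w <-> x <= z /\ z = w.
Proof. by rewrite /idfilter; case: ifP => xz; split=> // -[] // _ ->. Qed.

Lemma idfilter_iso x : pfilter_iso (idfilter x).
Proof.
exists x, x; split.
- rewrite eqEsubset; split=> z; first by move=> [w /idfilterP[]].
  by move=> xz; exists z; apply/idfilterP.
- rewrite eqEsubset; split=> w; first by move=> [z /idfilterP[? <-]].
  by move=> xw; exists w; apply/idfilterP.
- by move=> z1 z2 w1 w2 /idfilterP[_ ->] /idfilterP[_ ->].
Qed.

(** The preimage is picked by classical choice; it is unique because order isomorphisms are
    injective. *)
Definition pinv f w : option T :=
  if pselect (exists z, f z = Some w) is left e then Some (projT1 (cid e))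
  else None.

Lemma pinvP f z w : porder_iso f -> pinv f w = Some z <-> f z = Some w.
Proof.
move=> fI; rewrite /pinv; case: pselect => [e|ne]; last first.
  by split=> // fz; case: ne; exists z.
case: cid => t /= ft; split=> [[<-] //|fz].
by rewrite (porder_iso_inj fI ft fz).
Qed.

Lemma pinv_iso f : pfilter_iso f -> pfilter_iso (pinv f).
Proof.
move=> [x [y [fD fR fI]]]; exists y, x; split.
- rewrite -fR eqEsubset; split=> w [z] /(pinvP _ _ fI) fz; first by exists z.
  by exists z.
- rewrite -fD eqEsubset; split=> z [w].
    by move=> /(pinvP _ _ fI) fz; exists w.
  by move=> fz; exists w; apply/(pinvP _ _ fI).
- move=> z1 z2 w1 w2 /(pinvP _ _ fI) f1 /(pinvP _ _ fI) f2.
  by rewrite (fI _ _ _ _ f1 f2).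
Qed.

End PartialIsomorphisms.

(** * Idempotents and partial inverses in the semigroup *)

Section Ipf.
Variable n : nat.
Implicit Types (a b : ipf n) (x y z w : Npow n).
Local Open Scope order_scope.
Local Open Scope group_scope.

Definition ipf_eps x : ipf n := Ipf (idfilter_iso x).
Definition ipf_inv a : ipf n := Ipf (pinv_iso (ipf_iso a)).

Lemma ipf_porder_iso a : porder_iso a.
Proof. by case: (ipf_iso a) => x [y []]. Qed.

Lemma ipf_mulP a b z w :
  (a * b) z = Some w <-> exists2 t, a z = Some t & b t = Some w.
Proof.
change ((a * b) z) with (obind b (a z)).
case: (a z) => [t|] /=; last by split=> // -[].
by split=> [bt|[s [<-]] //]; exists t.
Qed.

Lemma ipf_epsP x z w : ipf_eps x z = Some w <-> x <= z /\ z = w.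
Proof. exact: idfilterP. Qed.

Lemma ipf_invP a z w : ipf_inv a w = Some z <-> a z = Some w.
Proof. exact/pinvP/ipf_porder_iso. Qed.

Lemma ipf_eqP a b : (forall z w, a z = Some w <-> b z = Some w) -> a = b.
Proof.
move=> ab; apply: ipf_ext => z.
case az: (a z) => [w|]; first by apply/esym/ab.
by case bz: (b z) => [w|//]; rewrite (iffRL (ab z w) bz) in az.
Qed.

Lemma ipf_dom_up a x w z : a x = Some w -> x <= z -> exists t, a z = Some t.
Proof.
case: (ipf_iso a) => u [v [aD _ _]] ax xz.
have ux : pfilter u x by rewrite -aD; exists w.
have uz : pfilter u z by apply: le_trans ux xz.
by rewrite -aD in uz.
Qed.

Lemma ipf_img_up a x y w : a x = Some y -> y <= w -> exists z, a z = Some w.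
Proof.
move=> /ipf_invP ay /(ipf_dom_up ay)[z /ipf_invP az].
by exists z.
Qed.

Lemma ipf_eps_mul x y : ipf_eps x * ipf_eps y = ipf_eps (x `|` y).
Proof.
apply: ipf_eqP => z w; rewrite ipf_epsP leUx; split.
  by move=> /ipf_mulP[t /ipf_epsP[-> <-] /ipf_epsP[-> ->]].
move=> [/andP[xz yz] <-]; apply/ipf_mulP.
by exists z; apply/ipf_epsP.
Qed.

(** The image of [a] is upward closed, so [a] maps the filter above [z] onto the whole filter above
    [w]. *)
Lemma ipf_conj_eps a z w : a z = Some w ->
  ipf_inv a * ipf_eps z * a = ipf_eps w.
Proof.
move=> az; apply: ipf_eqP => u v; split.
  move=> /ipf_mulP[t /ipf_mulP[s /ipf_invP asu /ipf_epsP[zs <-]]].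
  rewrite asu => -[<-]; apply/ipf_epsP; split=> //.
  by rewrite (ipf_porder_iso az asu).
move=> /ipf_epsP[wu <-]; have [s asu] := ipf_img_up az wu.
apply/ipf_mulP; exists s => //; apply/ipf_mulP; exists s.
  exact/ipf_invP.
by apply/ipf_epsP; split=> //; rewrite -(ipf_porder_iso az asu).
Qed.

(** The image of [a] is a principal filter, and [y] is its generator. *)
Lemma ipf_mulVe a : exists y, ipf_inv a * a = ipf_eps y.
Proof.
case: (ipf_iso a) => x [y [_ aR _]]; exists y; apply: ipf_eqP => u v.
have imE w : (exists z, a z = Some w) <-> y <= w.
  by rewrite -[is_true (y <= w)]/(pfilter y w) -aR.
rewrite ipf_epsP -imE; split.
  move=> /ipf_mulP[t /ipf_invP au av]; split; first by exists t.
  by move: av; rewrite au => -[].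
move=> [[z az] <-]; apply/ipf_mulP; exists z => //; exact/ipf_invP.
Qed.

Lemma ipf_invK a : ipf_inv (ipf_inv a) = a.
Proof. by apply: ipf_eqP => z w; rewrite !ipf_invP. Qed.

Lemma ipf_mulVe_restr a z w : a z = Some w ->
  ipf_inv (ipf_eps z * a) * (ipf_eps z * a) = ipf_eps w.
Proof.
move=> az; have [y ey] := ipf_mulVe (ipf_eps z * a).
rewrite ey; congr ipf_eps; apply: le_anti.
have caz : (ipf_eps z * a) z = Some w.
  by apply/ipf_mulP; exists z => //; apply/ipf_epsP.
(* The product is defined at [w], hence [y <= w]; conversely [y] is the value of [a] at a point
   above [z], hence [w <= y]. *)
have yw : ipf_eps y w = Some w.
  by rewrite -ey; apply/ipf_mulP; exists z => //; apply/ipf_invP.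
have : ipf_eps y y = Some y by apply/ipf_epsP.
rewrite -ey => /ipf_mulP[t /ipf_invP/ipf_mulP[s /ipf_epsP[zt <-] aty] _].
by move/ipf_epsP: yw => [-> _]; rewrite (ipf_porder_iso az aty).
Qed.

Lemma ipf_mulV_restr a z w : a z = Some w ->
  (ipf_eps z * a) * ipf_inv (ipf_eps z * a) = ipf_eps z.
Proof.
move=> az; apply: ipf_eqP => u v; split.
  move=> /ipf_mulP[t au /ipf_invP av].
  have <- := porder_iso_inj (@ipf_porder_iso _) au av.
  by move/ipf_mulP: au => [s /ipf_epsP[zu _] _]; apply/ipf_epsP.
move=> /ipf_epsP[zu <-]; have [t au] := ipf_dom_up az zu.
have cu : (ipf_eps z * a) u = Some t.
  by apply/ipf_mulP; exists u => //; apply/ipf_epsP.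
by apply/ipf_mulP; exists t => //; apply/ipf_invP.
Qed.

(* Zero-based coordinates, so that N^n is identified with nat-valued
   functions on 'I_n. *)
Definition npt (f : 'I_n -> nat) : Npow n :=
  [tuple (exist _ (f i).+1 isT : posnat) | i < n].
Definition ncoord x (i : 'I_n) : nat := (val (tnth x i)).-1.

Lemma npt_le f g : (npt f <= npt g) = [forall i, (f i <= g i)%N].
Proof.
by rewrite le_NpowE; apply: eq_forallb => i; rewrite !tnth_mktuple.
Qed.

Lemma ncoordK x : npt (ncoord x) = x.
Proof.
apply: eq_from_tnth => i; rewrite tnth_mktuple; apply: val_inj => /=.
by rewrite /ncoord prednK //; exact: (valP (tnth x i)).
Qed.

Lemma nptK f : ncoord (npt f) =1 f.
Proof. by move=> i; rewrite /ncoord tnth_mktuple. Qed.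

Lemma eq_npt f g : f =1 g -> npt f = npt g.
Proof.
by move=> fg; apply: eq_mktuple => i; apply: val_inj => /=; rewrite fg.
Qed.

Lemma ncoord_le x y : (x <= y) = [forall i, (ncoord x i <= ncoord y i)%N].
Proof. by rewrite -{1}(ncoordK x) -{1}(ncoordK y) npt_le. Qed.

Lemma ncoord_inj x y : ncoord x =1 ncoord y -> x = y.
Proof. by move=> /eq_npt; rewrite !ncoordK. Qed.

(** The displacement from [x] to [z] has its coordinates permuted by [s] and is added to [y]; the
    truncated subtraction is exact since [x <= z]. *)
Definition permshift (s : {perm 'I_n}) x y z : option (Npow n) :=
  if x <= z then
    Some (npt (fun i => ncoord y i + (ncoord z (s i) - ncoord x (s i)))%N)
  else None.

Lemma permshiftP s x y z w : permshift s x y z = Some w <->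
  x <= z /\ forall i,
    (ncoord w i = ncoord y i + (ncoord z (s i) - ncoord x (s i)))%N.
Proof.
rewrite /permshift; case: ifP => xz; last by split=> // -[].
split=> [[<-]|[_ wE]]; first by split=> // i; rewrite nptK.
by congr Some; apply: ncoord_inj => i; rewrite nptK wE.
Qed.

Lemma permshift_iso s x y : pfilter_iso (permshift s x y).
Proof.
exists x, y; split.
- rewrite eqEsubset; split=> z; first by move=> [w /permshiftP[]].
  by rewrite /pfilter /= => xz; eexists; rewrite /permshift xz.
- rewrite eqEsubset; split=> w; rewrite /pfilter /=.
    move=> [z /permshiftP[_ wE]]; rewrite ncoord_le.
    by apply/forallP => i; rewrite wE leq_addr.
  rewrite ncoord_le => /forallP yw.
  (* The displacement from [y] to [w] is permuted back and added to [x]. *)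
  exists (npt (fun i => ncoord x i
    + (ncoord w ((s^-1)%g i) - ncoord y ((s^-1)%g i)))%N).
  apply/permshiftP; split=> [|i].
    by rewrite ncoord_le; apply/forallP => i; rewrite nptK leq_addr.
  by rewrite nptK permK addKn subnKC.
- move=> z1 z2 w1 w2 /permshiftP[xz1 w1E] /permshiftP[xz2 w2E].
  move: xz1 xz2; rewrite !ncoord_le => /forallP xz1 /forallP xz2.
  apply/forallP/forallP => le12 i.
    have := le12 ((s^-1)%g i); rewrite w1E w2E permKV.
    by have := xz1 i; have := xz2 i; lia.
  rewrite w1E w2E leq_add2l.
  by have := le12 (s i); have := xz1 (s i); have := xz2 (s i); lia.
Qed.

Definition ipf_permshift s x y : ipf n := Ipf (permshift_iso s x y).

(** In zero-based coordinates the zero function is the least point, so its filter is everything. *)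
Lemma ipf_mul1e a : ipf_eps (npt (fun=> 0%N)) * a = a.
Proof.
apply: ipf_eqP => z w; split=> [/ipf_mulP[t /ipf_epsP[_ <-]] //|az].
apply/ipf_mulP; exists z => //; apply/ipf_epsP; split=> //.
by rewrite ncoord_le; apply/forallP => i; rewrite nptK.
Qed.

Lemma ipf_mule1 a : a * ipf_eps (npt (fun=> 0%N)) = a.
Proof.
apply: ipf_eqP => z w; split=> [/ipf_mulP[t at_ /ipf_epsP[_ <-]] //|az].
apply/ipf_mulP; exists w => //; apply/ipf_epsP; split=> //.
by rewrite ncoord_le; apply/forallP => i; rewrite nptK.
Qed.

(** * Congruent idempotents *)

Section Congruence.
Variable C : congruence (ipf n).

(** Multiplying the given pair by [ipf_eps w] raises [x] to [w] and fixes [y]. *)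
Lemma cong_eps_sandwich x w y : x <= w -> w <= y ->
  C (ipf_eps x) (ipf_eps y) -> C (ipf_eps x) (ipf_eps w).
Proof.
move=> xw wy Cxy; apply: cong_trans (Cxy) _; apply: cong_sym.
have := cong_mul2l (ipf_eps w) Cxy.
by rewrite !ipf_eps_mul (join_l xw) (join_r wy).
Qed.

Lemma cong_eps_transport a x y z w : a x = Some z -> a y = Some w ->
  C (ipf_eps x) (ipf_eps y) -> C (ipf_eps z) (ipf_eps w).
Proof.
move=> ax ay Cxy; rewrite -(ipf_conj_eps ax) -(ipf_conj_eps ay).
exact/cong_mul2r/cong_mul2l.
Qed.

(** With [u] the generator of the domain of [b], [ipf_eps z] is congruent to [ipf_eps z * b * c].
    Left multiplication by [ipf_eps (z | u)], with the join inside, fixes the latter and turns the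
    former into the idempotent of a strictly larger point. *)
Lemma cong_undef a b z w : C a b -> a z = Some w -> b z = None ->
  exists x y, x < y /\ C (ipf_eps x) (ipf_eps y).
Proof.
move=> Cab az bz; case: (ipf_iso b) => u [v [bD _ _]].
pose c := ipf_inv (ipf_eps z * a).
have uz : ~~ (u <= z).
  apply/negP => uz; have : pfilter u z by [].
  by rewrite -bD => -[t]; rewrite bz.
have ub : ipf_eps u * b = b.
  apply: ipf_eqP => s t; split=> [/ipf_mulP[r /ipf_epsP[_ <-]] //|bs].
  apply/ipf_mulP; exists s => //; apply/ipf_epsP; split=> //.
  by rewrite -[is_true (u <= s)]/(pfilter u s) -bD; exists t.
exists z, (z `|` u); split; first by rewrite lt_neqAle leUl andbT eq_sym eq_joinl.
have Cz : C (ipf_eps z) (ipf_eps z * b * c).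
  by rewrite -{1}(ipf_mulV_restr az); apply/cong_mul2r/cong_mul2l.
apply: cong_trans (Cz) _; apply: cong_sym.
have := cong_mul2l (ipf_eps (z `|` u)) Cz.
rewrite ipf_eps_mul joinC joinA joinxx.
rewrite !mulgA ipf_eps_mul [_ `|` z]joinC joinA joinxx.
by rewrite -ipf_eps_mul -(mulgA _ _ b) ub.
Qed.

(** Here [ipf_eps p] is congruent to a map with image above [q]. Right multiplication by [ipf_eps q]
    fixes that map and raises [p] to its join with [q]. *)
Lemma cong_differ a b z p q : C a b -> a z = Some p -> b z = Some q ->
  ~~ (q <= p) -> exists x y, x < y /\ C (ipf_eps x) (ipf_eps y).
Proof.
move=> Cab az bz qp; exists p, (p `|` q).
split; first by rewrite lt_neqAle leUl andbT eq_sym eq_joinl.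
pose c := ipf_inv (ipf_eps z * a).
have zbq : ipf_eps z * b * ipf_eps q = ipf_eps z * b.
  apply: ipf_eqP => s t; split; first by move=> /ipf_mulP[r br /ipf_epsP[_ <-]].
  move=> zbs; apply/ipf_mulP; exists t => //; apply/ipf_epsP; split=> //.
  move/ipf_mulP: zbs => [r /ipf_epsP[zs <-] bs].
  by rewrite (ipf_porder_iso bz bs).
have Cp : C (ipf_eps p) (c * (ipf_eps z * b)).
  by rewrite -(ipf_mulVe_restr az); apply/cong_mul2l/cong_mul2l.
apply: cong_trans (Cp) _; apply: cong_sym.
by have := cong_mul2r (ipf_eps q) Cp; rewrite -mulgA zbq ipf_eps_mul.
Qed.

Lemma nonidentity_cong_eps : ~ identity_congruence C ->
  exists x y, x < y /\ C (ipf_eps x) (ipf_eps y).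
Proof.
move=> nC; apply: contrapT => nlt; apply: nC => a b.
split=> [Cab|<-]; last exact: cong_refl.
apply: ipf_ext => z; case az: (a z) => [p|]; case bz: (b z) => [q|] //.
(* By antisymmetry, distinct values violate one of the two inequalities; each violation is a case of
   [cong_differ]. *)
- congr Some; apply: le_anti; apply/andP; split; apply: contrapT => /negP le.
    exact: nlt (cong_differ (cong_sym Cab) bz az le).
  exact: nlt (cong_differ Cab az bz le).
- case: nlt; exact: (cong_undef Cab az bz).
- case: nlt; exact: (cong_undef (cong_sym Cab) bz az).
Qed.

Lemma cong_eps_step x y f j : x < y -> C (ipf_eps x) (ipf_eps y) ->
  C (ipf_eps (npt f)) (ipf_eps (npt (fun i => f i + (i == j))%N)).
Proof.
move=> xy Cxy; have xley := ltW xy.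
have [i xi] : exists i, (ncoord x i < ncoord y i)%N.
  apply/existsP; apply: contraTT xy => /existsPn xi.
  rewrite lt_neqAle negb_and negbK; apply/orP; left; rewrite eq_le xley.
  by rewrite ncoord_le; apply/forallP => i; rewrite leqNgt.
(* The transposition moves the strict increase at [i] to coordinate [j], so the image of [y]
   dominates [f] plus the [j]-th unit vector. *)
pose a := ipf_permshift (tperm j i) x (npt f).
have ax : a x = Some (npt f).
  by apply/permshiftP; split=> // k; rewrite subnn addn0.
have [w ay] := ipf_dom_up ax xley.
have /permshiftP[_ wE] := ay.
apply: (cong_eps_sandwich _ _ (cong_eps_transport ax ay Cxy)).
  by rewrite npt_le; apply/forallP => k; rewrite leq_addr.
rewrite ncoord_le; apply/forallP => k; rewrite nptK wE nptK leq_add2l.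
by case: eqP => [->|//]; rewrite tpermL subn_gt0.
Qed.

Lemma cong_eps_total x y f : x < y -> C (ipf_eps x) (ipf_eps y) ->
  C (ipf_eps (npt (fun=> 0%N))) (ipf_eps (npt f)).
Proof.
(* Induction on the coordinate sum, lowering a positive coordinate by one. *)
move=> xy Cxy; have [m] := ubnP (\sum_i f i)%N.
elim: m f => // m IHm f fm.
have [/existsP[j fj]|] := boolP [exists j, 0 < f j]%N; last first.
  move=> /existsPn f0; rewrite (@eq_npt f (fun=> 0%N)); first exact: cong_refl.
  by move=> i; apply/eqP; rewrite -leqn0 leqNgt.
pose g i := (f i - (i == j))%N.
have fE : f =1 (fun i => g i + (i == j))%N.
  by move=> i; rewrite subnK //; case: eqP => [->|].
rewrite (eq_npt fE); apply: cong_trans (cong_eps_step _ _ xy Cxy).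
apply: IHm; move: fm; rewrite (eq_bigr _ (fun i _ => fE i)) big_split /=.
by rewrite (bigD1 j) //= [X in (_ + X)%N](bigD1 j) //= eqxx; lia.
Qed.

End Congruence.
End Ipf.

Theorem theorem2p12 (n : nat) (n_gt0 : 0 < n) (C : congruence (ipf n)) :
  ~ identity_congruence C -> group_congruence C.
Proof.
move=> /nonidentity_cong_eps[x [y [xy Cxy]]].
have C1 z : C (ipf_eps z) (ipf_eps (npt (fun=> 0))).
  by rewrite -(ncoordK z); apply/cong_sym/(cong_eps_total _ xy).
exists (\pi_(cong_quot C)%qT (ipf_eps (npt (fun=> 0)))).
(* The class of the partial inverse of a representative: both of its products with the
   representative are idempotents, hence congruent to the unit. *)
exists (fun q => \pi_(cong_quot C)%qT (ipf_inv (repr q))).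
split=> q; rewrite -[q in LHS]reprK [LHS]cong_quot_mulE.
- by rewrite ipf_mul1e reprK.
- by rewrite ipf_mule1 reprK.
- rewrite reprK; apply/cong_quotP.
  by have [z ->] := ipf_mulVe (repr q).
- rewrite reprK; apply/cong_quotP.
  (* Rewriting the first factor as a double inverse reduces the right inverse law to [ipf_mulVe]. *)
  by rewrite -{1}[repr q]ipf_invK; have [z ->] := ipf_mulVe (ipf_inv (repr q)).
Qed.
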